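(* Let $A\in\mathbf{R}^{n\times n}$ be symmetric with eigen-pairs $(\lambda_i,v_i)$, $i=1,\dots,n$, where $\lambda_n\le\cdots\le\lambda_1$ and $|\lambda_n|\le|\lambda_1|$, let $b\in\mathbf{R}^n$, and let $f(x)=\tfrac12 x^TAx-b^Tx$. Let $\alpha\ge 0$ be fixed and let $H:=I-\alpha A$. Given an initial point $x^{(0)}\in\mathbf{R}^n$, let $(x^{(k)})$ be the iterates of Gradient Descent applied to $f$ with fixed step size $\alpha$ (no momentum), and let $g^{(k)}$ denote the gradient of $f$ at $x^{(k)}$. Then for every $k\ge 0$, $$g^{(k+1)}=Hg^{(k)}=H^{k+1}g^{(0)}.$$
   Context: The gradient of $f$ is $g(x)=Ax-b$, and $g^{(k)}:=g(x^{(k)})=Ax^{(k)}-b$. Gradient Descent with fixed step size $\alpha$ is the iteration $x^{(k+1)}=x^{(k)}-\alpha g^{(k)}$ for $k\ge 0$. $I$ is the $n\times n$ identity matrix, and a matrix raised to the power zero is $I$. *)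

(* Defs.v *)
From mathcomp Require Import all_boot all_order all_algebra.
From mathcomp Require Import all_classical all_reals all_analysis.
Set Implicit Arguments.
Unset Strict Implicit.
Unset Printing Implicit Defensive.

Import Order.TTheory GRing.Theory Num.Theory numFieldNormedType.Exports.
Local Open Scope ring_scope.

Definition quadratic (R : realType) (n : nat) (A : 'M[R]_n) (b : 'cV[R]_n)
  (x : 'cV[R]_n) : R :=
  2^-1 * (x^T *m A *m x) ord0 ord0 - (b^T *m x) ord0 ord0.

Definition gradient (R : realType) (n : nat) (f : 'cV[R]_n.+1 -> R)
  (x : 'cV[R]_n.+1) : 'cV[R]_n.+1 :=
  \col_i 'D_(delta_mx i ord0) f x.

Fixpoint gradient_descent (R : realType) (n : nat) (f : 'cV[R]_n.+1 -> R)
  (alpha : R) (x0 : 'cV[R]_n.+1) (k : nat) : 'cV[R]_n.+1 :=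
  if k is j.+1 then
    let x := gradient_descent f alpha x0 j in x - alpha *: gradient f x
  else x0.

(* Stated on column vectors: the library's [eigenvalue] acts on row vectors. *)
Definition eigenpair (R : realType) (n : nat) (A : 'M[R]_n) (l : R)
  (v : 'cV[R]_n) : Prop :=
  v != 0 /\ A *m v = l *: v.

(* A full list of n eigen-pairs: linear independence of the eigenvectors makes
   the list contain every eigenvalue with its multiplicity (for A symmetric). *)
Definition eigensystem (R : realType) (n : nat) (A : 'M[R]_n)
  (lam : 'I_n -> R) (v : 'I_n -> 'cV[R]_n) : Prop :=
  (forall i, eigenpair A (lam i) (v i)) /\ row_free (\matrix_i (v i)^T).

(* Main.v *)
Require Import Defs.
From mathcomp Require Import all_boot all_order all_algebra.
From mathcomp Require Import all_classical all_reals all_analysis.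
From mathcomp Require Import ring.
Import Order.TTheory GRing.Theory Num.Theory numFieldNormedType.Exports.
Local Open Scope ring_scope.

(** Because A is symmetric, the directional derivatives of the quadratic
    f are those of its exact second-order expansion
      f (x + h u) = f x + h u^T (A x - b) + h^2/2 u^T A u,
    so the gradient of f at x is the residual A x - b ([gradient_quadratic]).
    A descent step x - alpha g therefore has residual
    (A x - b) - alpha A g = (I - alpha A) g: each step multiplies the gradient
    by the fixed matrix H = I - alpha A ([gradient_descent_step]), and the
    closed form H^(k+1) g^(0) follows by induction on k. *)

(** Symmetry of A enters here: the two cross terms u^T A x and x^T A u of the
    expansion are transposes of each other, so they merge and cancel the factor
    one half. *)
Lemma quadratic_expansion (R : realType) (n : nat) (A : 'M[R]_n)
    (b x u : 'cV[R]_n) (h : R) : A^T = A ->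
  quadratic A b (h *: u + x) =
    quadratic A b x + h * (u^T *m (A *m x - b)) ord0 ord0
    + h ^+ 2 / 2 * (u^T *m A *m u) ord0 ord0.
Proof.
move=> A_sym.
have swap (M : 'M[R]_1) : M ord0 ord0 = M^T ord0 ord0 by rewrite mxE.
have cross : (x^T *m A *m u) ord0 ord0 = (u^T *m A *m x) ord0 ord0.
  by rewrite swap !trmx_mul trmxK A_sym mulmxA.
have lin : (b^T *m u) ord0 ord0 = (u^T *m b) ord0 ord0.
  by rewrite swap trmx_mul trmxK.
have split_residual : (u^T *m (A *m x - b)) ord0 ord0 =
    (u^T *m A *m x) ord0 ord0 - (u^T *m b) ord0 ord0.
  by rewrite mulmxBr mulmxA !mxE.
have entryD (M N : 'M[R]_1) : (M + N) ord0 ord0 = M ord0 ord0 + N ord0 ord0.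
  by rewrite mxE.
have entryZ (c : R) (M : 'M[R]_1) : (c *: M) ord0 ord0 = c * M ord0 ord0.
  by rewrite mxE.
have trmx_step : (h *: u + x)^T = h *: u^T + x^T by rewrite linearD linearZ.
rewrite /quadratic split_residual trmx_step !mulmxDl !mulmxDr.
rewrite -!scalemxAl -!scalemxAr !entryD !entryZ cross lin.
by field.
Qed.

(** The second-order expansion turns the difference quotient into an affine
    function of h, whose limit at 0 is its constant term. *)
Lemma derive_quadratic (R : realType) (n : nat) (A : 'M[R]_n.+1)
    (b x u : 'cV[R]_n.+1) : A^T = A ->
  'D_u (quadratic A b) x = (u^T *m (A *m x - b)) ord0 ord0.
Proof.
move=> A_sym; rewrite /derive.
set l := (u^T *m (A *m x - b)) ord0 ord0.
set q := (u^T *m A *m u) ord0 ord0.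
have affine_cvg : ((l + h * (q / 2)) @[h --> (0 : R)] --> l)%classic.
  rewrite -[X in (_ --> X)%classic]addr0 -[X in (_ --> _ + X)%classic](mul0r (q / 2)).
  by apply: cvgD; [exact: cvg_cst | apply: cvgMl; exact: cvg_id].
apply: cvg_lim => //.
(* The quotient equals the affine function for h != 0 only, which is all that
   the punctured neighbourhoods of 0 in the derivative require. *)
apply: cvg_trans (cvg_within_filter _ affine_cvg).
apply: near_eq_cvg; near=> h.
have h_neq0 : h != 0 by near: h; exact: nbhs_dnbhs_neq.
rewrite /= quadratic_expansion // -/l -/q /GRing.scale /=.
by field.
Unshelve. all: by end_near. Qed.

Lemma gradient_quadratic (R : realType) (n : nat) (A : 'M[R]_n.+1)
    (b x : 'cV[R]_n.+1) : A^T = A ->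
  gradient (quadratic A b) x = A *m x - b.
Proof.
move=> A_sym; apply/colP => i.
by rewrite mxE derive_quadratic // trmx_delta -rowE mxE.
Qed.

Lemma gradient_descent_step (R : realType) (n : nat) (A : 'M[R]_n.+1)
    (b x0 : 'cV[R]_n.+1) (alpha : R) (k : nat) : A^T = A ->
  let f := quadratic A b in
  gradient f (gradient_descent f alpha x0 k.+1) =
    (1%:M - alpha *: A) *m gradient f (gradient_descent f alpha x0 k).
Proof.
move=> A_sym f /=; set x := gradient_descent f alpha x0 k.
rewrite {1}gradient_quadratic // mulmxBr mulmxBl mul1mx -scalemxAl -scalemxAr.
by rewrite addrAC -gradient_quadratic.
Qed.

(* The dimension is n.+1; lam ord0 is the largest eigenvalue and lam ord_max
   the smallest one. *)
Theorem corollary3 (R : realType) (n : nat) (A : 'M[R]_n.+1)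
  (lam : 'I_n.+1 -> R) (v : 'I_n.+1 -> 'cV[R]_n.+1)
  (b : 'cV[R]_n.+1) (alpha : R) (x0 : 'cV[R]_n.+1)
  (A_sym : A^T = A)
  (A_eig : eigensystem A lam v)
  (lam_noninc : forall i j : 'I_n.+1, (i <= j)%N -> lam j <= lam i)
  (lam_abs : `|lam ord_max| <= `|lam ord0|)
  (alpha_ge0 : 0 <= alpha) :
  let f := quadratic A b in
  let H : 'M[R]_n.+1 := 1%:M - alpha *: A in
  let x := gradient_descent f alpha x0 in
  let g := fun k : nat => gradient f (x k) in
  forall k : nat,
    g k.+1 = H *m g k /\ H *m g k = H ^+ k.+1 *m g 0%N.
Proof.
move=> f H x g.
have step k : g k.+1 = H *m g k by exact: gradient_descent_step.
have closed k : g k = H ^+ k *m g 0%N.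
  elim: k => [|k IHk]; first by rewrite expr0 mul1mx.
  by rewrite step IHk mulmxA exprS.
by move=> k; split; rewrite -?step.
Qed.
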